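(* Let $f_i=h_i+\overline{g_i}\in S_H$ with $h_i(z)+g_i(z)=\dfrac{z}{1-z}$ for $i=1,2$. Then for every $0\le t\le1$ the map $f=tf_1+(1-t)f_2$ belongs to $COD_H(0)$, i.e. $f\in S_H$ and $f$ maps $E$ onto a domain that is convex both in the direction of the real axis and in the direction of the imaginary axis.
   Context: $E=\{z\in\mathbb{C}:|z|<1\}$. $S_H$ denotes the class of harmonic, univalent, sense-preserving mappings $f=h+\overline{g}$ of $E$ ($h,g$ analytic, $h'\ne0$, $|g'/h'|<1$) normalized by $f(0)=0$, $f_z(0)=1$. A domain $\Omega$ is convex in the direction $\phi$ ($0\le\phi<\pi$) if every line parallel to the line through $0$ and $e^{i\phi}$ has connected or empty intersection with $\Omega$. $COD_H(\theta)$, $\theta\in[0,\pi/2)$, is the class of $f\in S_H$ mapping $E$ onto domains convex in the directions $\theta$ and $\theta+\pi/2$. *)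

(* Defs.v *)
From Stdlib Require Import Reals.
Open Scope R_scope.

Definition Cplx := (R * R)%type.

Definition Cadd (z w : Cplx) : Cplx := (fst z + fst w, snd z + snd w).
Definition Csub (z w : Cplx) : Cplx := (fst z - fst w, snd z - snd w).
Definition Cmul (z w : Cplx) : Cplx :=
  (fst z * fst w - snd z * snd w, fst z * snd w + snd z * fst w).
Definition Cconj (z : Cplx) : Cplx := (fst z, - snd z).
Definition Cnorm (z : Cplx) : R := sqrt (fst z * fst z + snd z * snd z).
Definition Cinv (z : Cplx) : Cplx :=
  let d := fst z * fst z + snd z * snd z in (fst z / d, - snd z / d).
Definition Cdiv (z w : Cplx) : Cplx := Cmul z (Cinv w).
Definition Cscale (r : R) (z : Cplx) : Cplx := (r * fst z, r * snd z).
Definition Czero : Cplx := (0, 0).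
Definition Cone : Cplx := (1, 0).

Definition inE (z : Cplx) : Prop := Cnorm z < 1.

Definition has_complex_deriv (F : Cplx -> Cplx) (z d : Cplx) : Prop :=
  forall eps : R, 0 < eps -> exists delta : R, 0 < delta /\
    forall w : Cplx, 0 < Cnorm (Csub w z) < delta ->
      Cnorm (Csub (Csub (F w) (F z)) (Cmul d (Csub w z))) <= eps * Cnorm (Csub w z).

Definition analytic_on_E_with (F F' : Cplx -> Cplx) : Prop :=
  forall z : Cplx, inE z -> has_complex_deriv F z (F' z).

Definition harm (h g : Cplx -> Cplx) : Cplx -> Cplx := fun z => Cadd (h z) (Cconj (g z)).

(** f = h + conj g (on E) belongs to S_H: h, g analytic on E, h' <> 0,
    |g'/h'| < 1 (sense-preserving), f univalent on E, f(0) = 0, f_z(0) = h'(0) = 1. *)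
Definition SH_decomp (h g : Cplx -> Cplx) : Prop :=
  exists h' g' : Cplx -> Cplx,
    analytic_on_E_with h h' /\ analytic_on_E_with g g' /\
    (forall z, inE z -> h' z <> Czero) /\
    (forall z, inE z -> Cnorm (Cdiv (g' z) (h' z)) < 1) /\
    (forall z w, inE z -> inE w -> harm h g z = harm h g w -> z = w) /\
    harm h g Czero = Czero /\
    h' Czero = Cone.

Definition in_SH (f : Cplx -> Cplx) : Prop :=
  exists h g : Cplx -> Cplx, (forall z, inE z -> f z = harm h g z) /\ SH_decomp h g.

Definition image_E (f : Cplx -> Cplx) (w : Cplx) : Prop := exists z, inE z /\ f z = w.

(** Omega is convex in the direction phi: every line a + s e^{i phi} (s real)
    meets Omega in a connected (= interval in the real parameter s) or empty set. *)
Definition convex_in_direction (Omega : Cplx -> Prop) (phi : R) : Prop :=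
  forall (a : Cplx) (s1 s2 s : R),
    Omega (Cadd a (Cscale s1 (cos phi, sin phi))) ->
    Omega (Cadd a (Cscale s2 (cos phi, sin phi))) ->
    s1 <= s <= s2 ->
    Omega (Cadd a (Cscale s (cos phi, sin phi))).

Definition in_COD_H (theta : R) (f : Cplx -> Cplx) : Prop :=
  in_SH f /\
  convex_in_direction (image_E f) theta /\
  convex_in_direction (image_E f) (theta + PI / 2).

(* Main.v *)
Require Import Defs.
From Stdlib Require Import Reals Lra Psatz ClassicalEpsilon.
From Coquelicot Require Import Rcomplements Rbar Hierarchy Continuity Derive RInt AutoDerive Derive_2d RInt_analysis.
Open Scope R_scope.

(** In the half-plane coordinate [w = z / (1 - z) = u + i v], [u > -1/2], the identity [h + g = w]
    turns [f = h + conj g] into [(u, v) |-> (u, B u v)] with [B = Im (2 h - w)], and [|g'| < |h'|]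
    into [Re (dh/dw) > 1/2], a condition preserved by convex combinations.  It says that [B] is
    strictly increasing in [v], which gives univalence and vertical convexity.  For horizontal
    convexity, let [B] take the value [y0] on two vertical lines.  High up, [B] is bounded below,
    and on both lines it is at least some [c > y0]; comparing the harmonic function [B] with a
    quadratic polynomial on long rectangles shows that [B] gets arbitrarily close to [c] on every
    line in between.  Symmetrically [B] gets below [y0] low down, so it takes the value [y0] there.
    The comparison rests on the mean value property, which comes from Goursat's theorem
    in polar coordinates since derivatives are not assumed continuous. *)

(** * Bisection of rectangles and attained minima *)

Lemma nested_intervals (a b : nat -> R) :
  (forall n, a n <= a (S n)) -> (forall n, b (S n) <= b n) ->
  (forall n, a n <= b n) -> exists x, forall n, a n <= x <= b n.
Proof.
  intros Ha Hb Hab.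
  assert (Ha' : forall n k, a n <= a (n + k)%nat).
  { intros n k; induction k as [|k IH].
    - rewrite Nat.add_0_r; lra.
    - rewrite Nat.add_succ_r; specialize (Ha (n + k)%nat); lra. }
  assert (Hb' : forall n k, b (n + k)%nat <= b n).
  { intros n k; induction k as [|k IH].
    - rewrite Nat.add_0_r; lra.
    - rewrite Nat.add_succ_r; specialize (Hb (n + k)%nat); lra. }
  assert (Hle : forall m n, a m <= b n).
  { intros m n; specialize (Ha' m n); specialize (Hb' n m).
    rewrite Nat.add_comm in Hb'; specialize (Hab (m + n)%nat); lra. }
  destruct (completeness (fun y => exists n, y = a n)) as [x [Hub Hlub]].
  - exists (b 0%nat); intros y [n ->]; apply Hle.
  - exists (a 0%nat); now exists 0%nat.
  - exists x; intros n; split.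
    + apply Hub; now exists n.
    + apply Hlub; intros y [m ->]; apply Hle.
Qed.

(** Bisection: if [P] fails on a rectangle it fails on one of the four quarters, and so on. The
    failing rectangles shrink to a point, around which the local hypothesis gives [P]. Degenerate
    rectangles are allowed. *)
Lemma rect_induction (P : R -> R -> R -> R -> Prop) (a0 b0 c0 d0 : R) :
  a0 <= b0 -> c0 <= d0 ->
  (forall a b c d, a <= b -> c <= d ->
     P a ((a + b) / 2) c ((c + d) / 2) -> P ((a + b) / 2) b c ((c + d) / 2) ->
     P a ((a + b) / 2) ((c + d) / 2) d -> P ((a + b) / 2) b ((c + d) / 2) d ->
     a0 <= a -> b <= b0 -> c0 <= c -> d <= d0 -> P a b c d) ->
  (forall x y, a0 <= x <= b0 -> c0 <= y <= d0 ->
     exists delta, 0 < delta /\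
       forall a b c d, a <= x <= b -> c <= y <= d ->
         a0 <= a -> b <= b0 -> c0 <= c -> d <= d0 ->
         b - a < delta -> d - c < delta -> P a b c d) ->
  P a0 b0 c0 d0.
Proof.
  intros Hab0 Hcd0 Hquarter Hlocal.
  apply NNPP; intros Hbad0.
  set (bad := fun r : (R * R) * (R * R) =>
    let '((a, b), (c, d)) := r in
    (a0 <= a /\ a <= b /\ b <= b0) /\ (c0 <= c /\ c <= d /\ d <= d0) /\ ~ P a b c d).
  set (child := fun r r' : (R * R) * (R * R) =>
    (fst (fst r) <= fst (fst r') /\ snd (fst r') <= snd (fst r) /\
     snd (fst r') - fst (fst r') = (snd (fst r) - fst (fst r)) / 2) /\
    (fst (snd r) <= fst (snd r') /\ snd (snd r') <= snd (snd r) /\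
     snd (snd r') - fst (snd r') = (snd (snd r) - fst (snd r)) / 2)).
  (* Classical logic provides a failing quarter; indefinite description makes it a function of the
     rectangle, so that [u] can be defined by recursion. *)
  assert (Hchild : forall r : {r | bad r}, {r' : {r | bad r} | child (proj1_sig r) (proj1_sig r')}).
  { intros [[[a b] [c d]] Hr].
    apply constructive_indefinite_description.
    destruct Hr as [[Ha [Hab Hb]] [[Hc [Hcd Hd]] HP]].
    apply NNPP; intros Hno; apply HP.
    apply Hquarter; trivial; apply NNPP; intros HnP; apply Hno.
    - assert (B : bad ((a, (a + b) / 2), (c, (c + d) / 2))) by (repeat split; trivial; lra).
      exists (exist _ _ B); unfold child; simpl; repeat split; lra.
    - assert (B : bad (((a + b) / 2, b), (c, (c + d) / 2))) by (repeat split; trivial; lra).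
      exists (exist _ _ B); unfold child; simpl; repeat split; lra.
    - assert (B : bad ((a, (a + b) / 2), ((c + d) / 2, d))) by (repeat split; trivial; lra).
      exists (exist _ _ B); unfold child; simpl; repeat split; lra.
    - assert (B : bad (((a + b) / 2, b), ((c + d) / 2, d))) by (repeat split; trivial; lra).
      exists (exist _ _ B); unfold child; simpl; repeat split; lra. }
  assert (B0 : bad ((a0, b0), (c0, d0))) by (repeat split; trivial; lra).
  set (u := fix u (n : nat) : {r | bad r} :=
    match n with O => exist _ _ B0 | S n => proj1_sig (Hchild (u n)) end).
  assert (Hu : forall n, child (proj1_sig (u n)) (proj1_sig (u (S n)))).
  { intros n; simpl; exact (proj2_sig (Hchild (u n))). }
  assert (Hub : forall n, bad (proj1_sig (u n))) by (intros n; exact (proj2_sig (u n))).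
  set (a := fun n => fst (fst (proj1_sig (u n)))).
  set (b := fun n => snd (fst (proj1_sig (u n)))).
  set (c := fun n => fst (snd (proj1_sig (u n)))).
  set (d := fun n => snd (snd (proj1_sig (u n)))).
  assert (Hb : forall n, (a0 <= a n /\ a n <= b n /\ b n <= b0) /\
     (c0 <= c n /\ c n <= d n /\ d n <= d0) /\ ~ P (a n) (b n) (c n) (d n)).
  { intros n; unfold a, b, c, d; generalize (proj1_sig (u n)) (Hub n).
    intros [[? ?] [? ?]] H; exact H. }
  assert (Hw : forall n, b n - a n = (b0 - a0) / 2 ^ n /\ d n - c n = (d0 - c0) / 2 ^ n).
  { induction n as [|n [IH1 IH2]].
    - unfold a, b, c, d; simpl; lra.
    - destruct (Hu n) as [[_ [_ H1]] [_ [_ H2]]].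
      fold (a n) (b n) (a (S n)) (b (S n)) in H1.
      fold (c n) (d n) (c (S n)) (d (S n)) in H2.
      rewrite H1, H2, IH1, IH2; simpl; split; field; apply pow_nonzero; lra. }
  destruct (nested_intervals a b) as [x Hx].
  { intros n; apply (Hu n). } { intros n; apply (Hu n). } { intros n; apply Hb. }
  destruct (nested_intervals c d) as [y Hy].
  { intros n; apply (Hu n). } { intros n; apply (Hu n). } { intros n; apply Hb. }
  destruct (Hlocal x y) as [delta [Hdelta Hloc]].
  { apply (Hx 0%nat). } { apply (Hy 0%nat). }
  destruct (cv_pow_half (b0 - a0) delta Hdelta) as [N1 HN1].
  destruct (cv_pow_half (d0 - c0) delta Hdelta) as [N2 HN2].
  set (n := max N1 N2).
  specialize (HN1 n (Nat.le_max_l _ _)); specialize (HN2 n (Nat.le_max_r _ _)).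
  unfold Rdist in HN1, HN2.
  destruct (Hw n) as [W1 W2].
  rewrite Rminus_0_r, <- W1 in HN1; rewrite Rminus_0_r, <- W2 in HN2.
  apply Rabs_def2 in HN1; apply Rabs_def2 in HN2.
  destruct (Hb n) as [[? [? ?]] [[? [? ?]] HP]].
  apply HP; apply Hloc; auto; lra.
Qed.

(** If no minimum is attained, each value of [f] is undercut somewhere, hence undercut on a whole
    neighbourhood by continuity. Bisection then yields one point lying strictly below every value of
    [f], including its own. *)
Lemma rect_minimum (f : R -> R -> R) (a b c d : R) :
  a <= b -> c <= d ->
  (forall x y, a <= x <= b -> c <= y <= d -> continuity_2d_pt f x y) ->
  exists x0 y0, a <= x0 <= b /\ c <= y0 <= d /\
    forall x y, a <= x <= b -> c <= y <= d -> f x0 y0 <= f x y.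
Proof.
  intros Hab Hcd Hf; apply NNPP; intros Hno.
  assert (Hlower : forall x y, a <= x <= b -> c <= y <= d ->
    exists x' y', a <= x' <= b /\ c <= y' <= d /\ f x' y' < f x y).
  { intros x y Hx Hy; apply NNPP; intros H; apply Hno.
    exists x, y; repeat split; try lra; intros x' y' Hx' Hy'.
    apply Rnot_lt_le; intros Hlt; apply H; exists x', y'; auto. }
  set (P := fun a' b' c' d' => exists x' y', a <= x' <= b /\ c <= y' <= d /\
    forall x y, a' <= x <= b' -> c' <= y <= d' -> f x' y' < f x y).
  assert (HP : P a b c d).
  { apply rect_induction; trivial.
    - intros a' b' c' d' _ _ H1 H2 H3 H4 _ _ _ _.
      destruct H1 as [x1 [y1 [X1 [Y1 H1]]]]; destruct H2 as [x2 [y2 [X2 [Y2 H2]]]].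
      destruct H3 as [x3 [y3 [X3 [Y3 H3]]]]; destruct H4 as [x4 [y4 [X4 [Y4 H4]]]].
      (* The lowest of the four undercutting points serves for the whole rectangle. *)
      assert (Hm : exists x' y', a <= x' <= b /\ c <= y' <= d /\ f x' y' <= f x1 y1 /\
        f x' y' <= f x2 y2 /\ f x' y' <= f x3 y3 /\ f x' y' <= f x4 y4).
      { destruct (Rle_dec (f x1 y1) (f x2 y2)); destruct (Rle_dec (f x3 y3) (f x4 y4));
        [ destruct (Rle_dec (f x1 y1) (f x3 y3)); [exists x1, y1 | exists x3, y3]
        | destruct (Rle_dec (f x1 y1) (f x4 y4)); [exists x1, y1 | exists x4, y4]
        | destruct (Rle_dec (f x2 y2) (f x3 y3)); [exists x2, y2 | exists x3, y3]
        | destruct (Rle_dec (f x2 y2) (f x4 y4)); [exists x2, y2 | exists x4, y4] ];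
        repeat split; lra. }
      destruct Hm as [x' [y' [X' [Y' [M1 [M2 [M3 M4]]]]]]].
      exists x', y'; split; trivial; split; trivial; intros x y Hx Hy.
      destruct (Rle_dec x ((a' + b') / 2)); destruct (Rle_dec y ((c' + d') / 2)).
      + specialize (H1 x y); lra.
      + specialize (H3 x y); lra.
      + specialize (H2 x y); lra.
      + specialize (H4 x y); lra.
    - intros x y Hx Hy.
      destruct (Hlower x y Hx Hy) as [x' [y' [X' [Y' Hlt]]]].
      assert (He : 0 < f x y - f x' y') by lra.
      destruct (Hf x y Hx Hy (mkposreal _ He)) as [[delta Hd] Hdelta]; simpl in Hdelta.
      exists delta; split; trivial.
      intros a' b' c' d' Ha' Hc' _ _ _ _ H1 H2.
      exists x', y'; split; trivial; split; trivial; intros u v Hu Hv.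
      assert (K : Rabs (f u v - f x y) < f x y - f x' y').
      { apply Hdelta; apply Rabs_def1; lra. }
      apply Rabs_def2 in K; lra. }
  destruct HP as [x' [y' [X' [Y' H]]]].
  specialize (H x' y' X' Y'); lra.
Qed.

(** * Goursat's theorem for closed forms on rectangles *)

Lemma continuity_2d_slices (f : R -> R -> R) (x y : R) :
  continuity_2d_pt f x y ->
  continuous (fun u => f u y) x /\ continuous (fun v => f x v) y.
Proof.
  intros H; split; apply continuity_pt_filterlim, continuity_pt_locally; intros eps;
    destruct (H eps) as [delta Hdelta]; exists delta; intros u Hu; apply Hdelta;
    solve [exact Hu | rewrite Rminus_diag, Rabs_R0; apply cond_pos].
Qed.

Lemma ex_RInt_slice_1 (f : R -> R -> R) (a b y : R) :
  a <= b -> (forall x, a <= x <= b -> continuity_2d_pt f x y) ->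
  ex_RInt (fun x => f x y) a b.
Proof.
  intros Hab H; apply (@ex_RInt_continuous R_CompleteNormedModule); intros x.
  rewrite Rmin_left, Rmax_right by trivial; intros Hx.
  apply (continuity_2d_slices f x y), H, Hx.
Qed.

Lemma ex_RInt_slice_2 (f : R -> R -> R) (x c d : R) :
  c <= d -> (forall y, c <= y <= d -> continuity_2d_pt f x y) ->
  ex_RInt (fun y => f x y) c d.
Proof.
  intros Hcd H; apply (@ex_RInt_continuous R_CompleteNormedModule); intros y.
  rewrite Rmin_left, Rmax_right by trivial; intros Hy.
  apply (continuity_2d_slices f x y), H, Hy.
Qed.

Lemma RInt_near_const (f : R -> R) (a b l M : R) :
  a <= b -> ex_RInt f a b -> (forall t, a <= t <= b -> Rabs (f t - l) <= M) ->
  Rabs (RInt f a b - l * (b - a)) <= (b - a) * M.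
Proof.
  intros Hab Hf HM.
  assert (Hc : ex_RInt (fun _ : R => l) a b) by apply ex_RInt_const.
  replace (RInt f a b - l * (b - a)) with (RInt (fun t => minus (f t) l) a b).
  - apply abs_RInt_le_const; trivial.
    apply (@ex_RInt_minus R_NormedModule); trivial.
  - rewrite (@RInt_minus R_CompleteNormedModule), RInt_const by trivial.
    unfold minus, plus, opp, scal; simpl; unfold mult; simpl; ring.
Qed.

(** The counterclockwise integral of [P dx + Q dy] along the boundary, opposite sides being paired
    under one integral. *)
Definition circulation (P Q : R -> R -> R) (a b c d : R) : R :=
  RInt (fun x => P x c - P x d) a b + RInt (fun y => Q b y - Q a y) c d.

(** Each inner side is traversed twice, in opposite directions. *)
Lemma circulation_quarter (P Q : R -> R -> R) (a b c d m n : R) :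
  a <= m <= b -> c <= n <= d ->
  (forall x y, a <= x <= b -> c <= y <= d -> continuity_2d_pt P x y /\ continuity_2d_pt Q x y) ->
  circulation P Q a b c d =
    circulation P Q a m c n + circulation P Q m b c n +
    (circulation P Q a m n d + circulation P Q m b n d).
Proof.
  intros Hm Hn Hcont.
  assert (HP : forall a' b' y, a <= a' -> a' <= b' -> b' <= b -> c <= y <= d ->
    ex_RInt (fun x => P x y) a' b').
  { intros; apply ex_RInt_slice_1; trivial; intros; apply Hcont; lra. }
  assert (HQ : forall c' d' x, c <= c' -> c' <= d' -> d' <= d -> a <= x <= b ->
    ex_RInt (fun y => Q x y) c' d').
  { intros; apply ex_RInt_slice_2; trivial; intros; apply Hcont; lra. }
  assert (SP : forall a' b' y y', a <= a' -> a' <= b' -> b' <= b -> c <= y <= d -> c <= y' <= d ->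
    RInt (fun x => P x y - P x y') a' b' = RInt (fun x => P x y) a' b' - RInt (fun x => P x y') a' b').
  { intros; apply (@RInt_minus R_CompleteNormedModule); apply HP; trivial. }
  assert (SQ : forall c' d' x x', c <= c' -> c' <= d' -> d' <= d -> a <= x <= b -> a <= x' <= b ->
    RInt (fun y => Q x y - Q x' y) c' d' = RInt (fun y => Q x y) c' d' - RInt (fun y => Q x' y) c' d').
  { intros; apply (@RInt_minus R_CompleteNormedModule); apply HQ; trivial. }
  assert (CP : forall y, c <= y <= d ->
    RInt (fun x => P x y) a b = RInt (fun x => P x y) a m + RInt (fun x => P x y) m b).
  { intros y Hy; symmetry; apply (@RInt_Chasles R_CompleteNormedModule); apply HP; lra. }
  assert (CQ : forall x, a <= x <= b ->
    RInt (fun y => Q x y) c d = RInt (fun y => Q x y) c n + RInt (fun y => Q x y) n d).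
  { intros x Hx; symmetry; apply (@RInt_Chasles R_CompleteNormedModule); apply HQ; lra. }
  unfold circulation.
  rewrite !SP, !SQ by lra.
  rewrite (CP c), (CP d), (CQ a), (CQ b) by lra; ring.
Qed.

(* Green's formula for a closed form [P dx + Q dy] whose partial derivatives need not be continuous,
   by Goursat's bisection. *)
Lemma goursat_rectangle (P Q : R -> R -> R) (a b c d : R) :
  a <= b -> c <= d ->
  (forall x y, a <= x <= b -> c <= y <= d -> exists p l q,
     differentiable_pt_lim P x y p l /\ differentiable_pt_lim Q x y l q) ->
  circulation P Q a b c d = 0.
Proof.
  intros Hab Hcd Hd.
  assert (Hcont : forall x y, a <= x <= b -> c <= y <= d ->
    continuity_2d_pt P x y /\ continuity_2d_pt Q x y).
  { intros x y Hx Hy; destruct (Hd x y Hx Hy) as [p [l [q [HP HQ]]]].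
    split; apply differentiable_continuity_pt; [now exists p, l | now exists l, q]. }
  (* The bound is [eps] times the square of the half perimeter: bisection divides that square by
     four, so the bounds of four quarters add up exactly. *)
  assert (Hbound : forall eps, 0 < eps ->
    Rabs (circulation P Q a b c d) <= eps * ((b - a) + (d - c)) ^ 2).
  { intros eps Heps.
    apply (rect_induction (fun a' b' c' d' =>
      Rabs (circulation P Q a' b' c' d') <= eps * ((b' - a') + (d' - c')) ^ 2)); trivial.
    - intros a' b' c' d' H1 H2 I1 I2 I3 I4 ? ? ? ?.
      rewrite (circulation_quarter P Q a' b' c' d' ((a' + b') / 2) ((c' + d') / 2));
        [ | lra | lra | intros; apply Hcont; lra].
      set (w := (b' - a') + (d' - c')).
      apply Rabs_le_between in I1; apply Rabs_le_between in I2.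
      apply Rabs_le_between in I3; apply Rabs_le_between in I4.
      apply Rabs_le_between.
      replace ((a' + b') / 2 - a' + ((c' + d') / 2 - c')) with (w / 2) in I1 by (unfold w; field).
      replace (b' - (a' + b') / 2 + ((c' + d') / 2 - c')) with (w / 2) in I2 by (unfold w; field).
      replace ((a' + b') / 2 - a' + (d' - (c' + d') / 2)) with (w / 2) in I3 by (unfold w; field).
      replace (b' - (a' + b') / 2 + (d' - (c' + d') / 2)) with (w / 2) in I4 by (unfold w; field).
      replace ((w / 2) ^ 2) with (w ^ 2 / 4) in * by field; lra.
    - intros x y Hx Hy; destruct (Hd x y Hx Hy) as [p [l [q [HP HQ]]]].
      assert (He : 0 < eps / 2) by lra.
      destruct (HP (mkposreal _ He)) as [[d1 Hd1] HP1].
      destruct (HQ (mkposreal _ He)) as [[d2 Hd2] HQ1]; simpl in HP1, HQ1.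
      exists (Rmin d1 d2); split; [now apply Rmin_pos | ].
      intros a' b' c' d' Ha Hc ? ? ? ? W1 W2.
      pose proof (Rmin_l d1 d2); pose proof (Rmin_r d1 d2).
      set (w := (b' - a') + (d' - c')).
      assert (Hmax : forall u v, a' <= u <= b' -> c' <= v <= d' ->
        eps / 2 * Rmax (Rabs (u - x)) (Rabs (v - y)) <= eps / 2 * w).
      { intros u v Hu Hv; apply Rmult_le_compat_l; [lra | ].
        apply Rmax_lub; apply Rabs_le_between; unfold w; lra. }
      assert (EP : forall u v, a' <= u <= b' -> c' <= v <= d' ->
        Rabs (P u v - P x y - (p * (u - x) + l * (v - y))) <= eps / 2 * w).
      { intros u v Hu Hv; eapply Rle_trans; [ | apply Hmax; eauto].
        apply HP1; apply Rabs_def1; lra. }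
      assert (EQ : forall u v, a' <= u <= b' -> c' <= v <= d' ->
        Rabs (Q u v - Q x y - (l * (u - x) + q * (v - y))) <= eps / 2 * w).
      { intros u v Hu Hv; eapply Rle_trans; [ | apply Hmax; eauto].
        apply HQ1; apply Rabs_def1; lra. }
      (* The affine approximations of [P] and [Q] share the mixed coefficient [l], so the main terms
         in [IP] and [IQ] are opposite and only the remainders survive. *)
      assert (IP : Rabs (RInt (fun u => P u c' - P u d') a' b' - l * (c' - d') * (b' - a'))
        <= (b' - a') * (eps * w)).
      { apply RInt_near_const; [lra | | ].
        - apply (@ex_RInt_minus R_NormedModule); apply ex_RInt_slice_1; try lra;
            intros; apply Hcont; lra.
        - intros u Hu.
          assert (K1 := EP u c' Hu); assert (K2 := EP u d' Hu).
          apply Rabs_le_between; rewrite Rabs_le_between in K1, K2; lra. }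
      assert (IQ : Rabs (RInt (fun v => Q b' v - Q a' v) c' d' - l * (b' - a') * (d' - c'))
        <= (d' - c') * (eps * w)).
      { apply RInt_near_const; [lra | | ].
        - apply (@ex_RInt_minus R_NormedModule); apply ex_RInt_slice_2; try lra;
            intros; apply Hcont; lra.
        - intros v Hv.
          assert (K1 := EQ b' v); assert (K2 := EQ a' v).
          apply Rabs_le_between; rewrite Rabs_le_between in K1, K2; lra. }
      unfold circulation.
      apply Rabs_le_between; rewrite Rabs_le_between in IP, IQ.
      replace (eps * w ^ 2) with ((b' - a') * (eps * w) + (d' - c') * (eps * w))
        by (unfold w; ring); lra. }
  (* A nonzero circulation contradicts the bound for [eps] equal to its absolute value over
     [w ^ 2 + 1]; the added 1 gives strictness and a nonzero denominator. *)
  apply NNPP; intros Hne.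
  apply Rabs_pos_lt in Hne.
  set (w := (b - a) + (d - c)) in *.
  assert (Hw : 0 < w ^ 2 + 1) by (pose proof (pow2_ge_0 w); lra).
  specialize (Hbound (Rabs (circulation P Q a b c d) / (w ^ 2 + 1)) (Rdiv_lt_0_compat _ _ Hne Hw)).
  apply (Rmult_le_compat_r (w ^ 2 + 1)) in Hbound; [ | lra].
  replace (Rabs (circulation P Q a b c d) / (w ^ 2 + 1) * w ^ 2 * (w ^ 2 + 1))
    with (Rabs (circulation P Q a b c d) * w ^ 2) in Hbound by (field; lra).
  lra.
Qed.

(** * Differentiation in two variables and the Cauchy-Riemann equations *)

Lemma differentiable_pt_lim_snd (f : R -> R) (x y l : R) :
  derivable_pt_lim f y l -> differentiable_pt_lim (fun _ v => f v) x y 0 l.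
Proof.
  intros Hf eps; destruct (differentiable_pt_lim_proj1_0 f y x l Hf eps) as [delta H].
  exists delta; intros u v Hu Hv; specialize (H v u Hv Hu).
  rewrite Rmax_comm, (Rplus_comm (0 * _)); exact H.
Qed.

Lemma differentiable_pt_lim_Rmult (x y : R) : differentiable_pt_lim Rmult x y y x.
Proof.
  intros eps; exists eps; intros u v Hu Hv.
  replace (u * v - x * y - (y * (u - x) + x * (v - y))) with ((u - x) * (v - y)) by ring.
  rewrite Rabs_mult; apply Rmult_le_compat; try apply Rabs_pos; [lra | apply Rmax_r].
Qed.

Lemma differentiable_pt_lim_mult (f g : R -> R -> R) (x y fx fy gx gy : R) :
  differentiable_pt_lim f x y fx fy -> differentiable_pt_lim g x y gx gy ->
  differentiable_pt_lim (fun u v => f u v * g u v) x y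
    (g x y * fx + f x y * gx) (g x y * fy + f x y * gy).
Proof.
  intros Hf Hg; apply (differentiable_pt_lim_comp Rmult); trivial.
  apply differentiable_pt_lim_Rmult.
Qed.

(** Affine functions of a single [f] are also obtained from this form, with [t = 0] and [f] repeated
    as a dummy. *)
Lemma differentiable_pt_lim_lin (f g : R -> R -> R) (s t c x y fx fy gx gy : R) :
  differentiable_pt_lim f x y fx fy -> differentiable_pt_lim g x y gx gy ->
  differentiable_pt_lim (fun u v => s * f u v + t * g u v + c) x y
    (s * fx + t * gx) (s * fy + t * gy).
Proof.
  intros Hf Hg; apply (differentiable_pt_lim_comp (fun u v => s * u + t * v + c)); trivial.
  intros eps; exists (mkposreal _ Rlt_0_1); intros u v _ _.
  replace (s * u + t * v + c - (s * f x y + t * g x y + c) - (s * (u - f x y) + t * (v - g x y)))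
    with 0 by ring.
  rewrite Rabs_R0; apply Rmult_le_pos; [left; apply cond_pos | ].
  eapply Rle_trans; [apply Rabs_pos | apply Rmax_l].
Qed.

Lemma differentiable_pt_lim_eq (f : R -> R -> R) (x y a b a' b' : R) :
  differentiable_pt_lim f x y a b -> a = a' -> b = b' -> differentiable_pt_lim f x y a' b'.
Proof. now intros H -> ->. Qed.

(** Complex differentiability of [A + i B] at [x + i y], with derivative [a + i b]. *)
Definition cauchy_riemann (A B : R -> R -> R) (x y : R) : Prop :=
  exists a b, differentiable_pt_lim A x y a (- b) /\ differentiable_pt_lim B x y b a.

Lemma cauchy_riemann_continuity (A B : R -> R -> R) (x y : R) :
  cauchy_riemann A B x y -> continuity_2d_pt B x y.
Proof.
  intros [a [b [_ HB]]]; apply differentiable_continuity_pt; now exists b, a.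
Qed.

(** * The mean value property on circles *)

Lemma differentiable_polar (x0 y0 r th : R) :
  differentiable_pt_lim (fun r th => x0 + r * cos th) r th (cos th) (- (r * sin th)) /\
  differentiable_pt_lim (fun r th => y0 + r * sin th) r th (sin th) (r * cos th).
Proof.
  assert (Hr : differentiable_pt_lim (fun u _ : R => u) r th 1 0).
  { apply (differentiable_pt_lim_proj1_0 (fun u => u)), derivable_pt_lim_id. }
  assert (Hc := differentiable_pt_lim_snd cos r th _ (derivable_pt_lim_cos th)).
  assert (Hs := differentiable_pt_lim_snd sin r th _ (derivable_pt_lim_sin th)).
  assert (Pc := differentiable_pt_lim_mult _ _ _ _ _ _ _ _ Hr Hc).
  assert (Ps := differentiable_pt_lim_mult _ _ _ _ _ _ _ _ Hr Hs).
  split.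
  - eapply differentiable_pt_lim_eq.
    + eapply differentiable_pt_lim_ext.
      2: exact (differentiable_pt_lim_lin _ _ 1 0 x0 _ _ _ _ _ _ Pc Pc).
      exists (mkposreal _ Rlt_0_1); intros; cbv beta; ring.
    + cbv beta; ring.
    + cbv beta; ring.
  - eapply differentiable_pt_lim_eq.
    + eapply differentiable_pt_lim_ext.
      2: exact (differentiable_pt_lim_lin _ _ 1 0 y0 _ _ _ _ _ _ Ps Ps).
      exists (mkposreal _ Rlt_0_1); intros; cbv beta; ring.
    + cbv beta; ring.
    + cbv beta; ring.
Qed.

(** The differences are left unreduced so as to match the disc hypotheses verbatim. *)
Lemma circle_in_disc (x0 y0 r s th : R) :
  0 <= r <= s -> (x0 + r * cos th - x0) ^ 2 + (y0 + r * sin th - y0) ^ 2 <= s ^ 2.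
Proof.
  intros Hr; pose proof (sin2_cos2 th) as E; unfold Rsqr in E.
  replace ((x0 + r * cos th - x0) ^ 2 + (y0 + r * sin th - y0) ^ 2)
    with (r ^ 2 * (sin th * sin th + cos th * cos th)) by ring.
  rewrite E; nra.
Qed.

Lemma ex_RInt_circle (A B : R -> R -> R) (x0 y0 r s : R) :
  0 <= r <= s ->
  (forall x y, (x - x0) ^ 2 + (y - y0) ^ 2 <= s ^ 2 -> cauchy_riemann A B x y) ->
  ex_RInt (fun th => B (x0 + r * cos th) (y0 + r * sin th)) 0 (2 * PI).
Proof.
  intros Hr Hcr; pose proof PI_RGT_0.
  apply (ex_RInt_slice_2 (fun r th => B (x0 + r * cos th) (y0 + r * sin th))); [lra | ].
  intros th _; destruct (Hcr _ _ (circle_in_disc x0 y0 r s th Hr)) as [a [b [_ Hb]]].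
  destruct (differentiable_polar x0 y0 r th) as [D1 D2].
  apply differentiable_continuity_pt; do 2 eexists.
  exact (differentiable_pt_lim_comp _ _ _ _ _ _ _ _ _ _ _ Hb D1 D2).
Qed.

(* [B dth + A dr / r] is the imaginary part of [(A + i B) dz / z], and [A dr / r - B dth] its
   real part; the latter is closed, and its integrals over the sides th = 0 and th = 2 PI cancel. *)
Lemma circle_mean_independent (A B : R -> R -> R) (x0 y0 r1 r2 : R) :
  0 < r1 <= r2 ->
  (forall x y, (x - x0) ^ 2 + (y - y0) ^ 2 <= r2 ^ 2 -> cauchy_riemann A B x y) ->
  RInt (fun th => B (x0 + r1 * cos th) (y0 + r1 * sin th)) 0 (2 * PI) =
  RInt (fun th => B (x0 + r2 * cos th) (y0 + r2 * sin th)) 0 (2 * PI).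
Proof.
  intros Hr Hcr.
  pose proof PI_RGT_0.
  set (P := fun r th => A (x0 + r * cos th) (y0 + r * sin th) * / r).
  set (Q := fun r th => - B (x0 + r * cos th) (y0 + r * sin th)).
  assert (HB : forall r, 0 < r <= r2 ->
    ex_RInt (fun th => B (x0 + r * cos th) (y0 + r * sin th)) 0 (2 * PI)).
  { intros r Hr'; apply (ex_RInt_circle A B x0 y0 r r2); [lra | exact Hcr]. }
  assert (HG : circulation P Q r1 r2 0 (2 * PI) = 0).
  { apply goursat_rectangle; [lra | lra | ].
    intros r th Hr' _; assert (Hr0 : 0 <= r <= r2) by lra.
    destruct (Hcr _ _ (circle_in_disc x0 y0 r r2 th Hr0)) as [a [b [Ha Hb]]].
    destruct (differentiable_polar x0 y0 r th) as [D1 D2].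
    assert (EA := differentiable_pt_lim_comp _ _ _ _ _ _ _ _ _ _ _ Ha D1 D2).
    assert (EB := differentiable_pt_lim_comp _ _ _ _ _ _ _ _ _ _ _ Hb D1 D2).
    assert (EI : differentiable_pt_lim (fun u _ : R => / u) r th (- 1 / r ^ 2) 0).
    { apply differentiable_pt_lim_proj1_0, is_derive_Reals; auto_derive; [lra | field; lra]. }
    (* The product rule for [P] fixes the common mixed derivative; that [Q] has the same one is a
       Cauchy-Riemann equation in polar form. *)
    do 3 eexists; split.
    - eapply differentiable_pt_lim_eq.
      + exact (differentiable_pt_lim_mult _ _ _ _ _ _ _ _ EA EI).
      + reflexivity.
      + reflexivity.
    - eapply differentiable_pt_lim_eq.
      + eapply differentiable_pt_lim_ext.
        2: exact (differentiable_pt_lim_lin _ _ (-1) 0 0 _ _ _ _ _ _ EB EB).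
        exists (mkposreal _ Rlt_0_1); intros; unfold Q; ring.
      + cbv beta; field; lra.
      + reflexivity. }
  unfold circulation in HG.
  rewrite (RInt_ext _ (fun _ => 0)) in HG.
  2: { intros r _; unfold P; rewrite cos_2PI, sin_2PI, cos_0, sin_0; apply Rminus_diag. }
  rewrite RInt_const in HG.
  rewrite (RInt_ext _ (fun th => minus (B (x0 + r1 * cos th) (y0 + r1 * sin th))
    (B (x0 + r2 * cos th) (y0 + r2 * sin th)))) in HG.
  2: { intros th _; unfold Q, minus, plus, opp; simpl; ring. }
  rewrite (@RInt_minus R_CompleteNormedModule) in HG by (apply HB; lra).
  unfold scal, minus, plus, opp in HG; simpl in HG; unfold mult in HG; simpl in HG; lra.
Qed.

(** The mean does not depend on the radius, and on small circles continuity puts [B] close to its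
    value at the centre. *)
Lemma circle_mean_value (A B : R -> R -> R) (x0 y0 r : R) :
  0 < r ->
  (forall x y, (x - x0) ^ 2 + (y - y0) ^ 2 <= r ^ 2 -> cauchy_riemann A B x y) ->
  ex_RInt (fun th => B (x0 + r * cos th) (y0 + r * sin th)) 0 (2 * PI) /\
  RInt (fun th => B (x0 + r * cos th) (y0 + r * sin th)) 0 (2 * PI) = 2 * PI * B x0 y0.
Proof.
  intros Hr Hcr.
  pose proof PI_RGT_0.
  assert (HI : forall s, 0 < s <= r ->
    ex_RInt (fun th => B (x0 + s * cos th) (y0 + s * sin th)) 0 (2 * PI)).
  { intros s Hs; apply (ex_RInt_circle A B x0 y0 s r); [lra | exact Hcr]. }
  split; [apply HI; lra | ].
  apply NNPP; intros Hne.
  set (I := RInt (fun th => B (x0 + r * cos th) (y0 + r * sin th)) 0 (2 * PI)) in *.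
  (* Integrated over a length [2 * PI], this accuracy leaves an error of at most half the supposed
     discrepancy. *)
  assert (He : 0 < Rabs (I - B x0 y0 * (2 * PI - 0)) / (4 * PI)).
  { apply Rdiv_lt_0_compat; [apply Rabs_pos_lt; lra | lra]. }
  assert (HC : continuity_2d_pt B x0 y0).
  { apply (cauchy_riemann_continuity A), Hcr; nra. }
  destruct (HC (mkposreal _ He)) as [[delta Hd] Hdelta]; simpl in Hdelta.
  set (s := Rmin r (delta / 2)).
  assert (Hs : 0 < s <= r) by (split; [apply Rmin_pos; lra | apply Rmin_l]).
  assert (Hs' : s <= delta / 2) by apply Rmin_r.
  assert (HIs : Rabs (I - B x0 y0 * (2 * PI - 0)) <=
    (2 * PI - 0) * (Rabs (I - B x0 y0 * (2 * PI - 0)) / (4 * PI))).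
  { unfold I at 1; rewrite <- (circle_mean_independent A B x0 y0 s r Hs Hcr).
    apply RInt_near_const; [lra | apply HI, Hs | ].
    intros th _; left; apply Hdelta.
    - replace (x0 + s * cos th - x0) with (s * cos th) by ring.
      pose proof (COS_bound th); apply Rabs_def1; nra.
    - replace (y0 + s * sin th - y0) with (s * sin th) by ring.
      pose proof (SIN_bound th); apply Rabs_def1; nra. }
  replace ((2 * PI - 0) * (Rabs (I - B x0 y0 * (2 * PI - 0)) / (4 * PI)))
    with (Rabs (I - B x0 y0 * (2 * PI - 0)) / 2) in HIs by (field; lra).
  assert (0 < Rabs (I - B x0 y0 * (2 * PI - 0))) by (apply Rabs_pos_lt; lra).
  lra.
Qed.

(** * Comparison on rectangles and strips *)

Lemma disc_in_square (p q r : R) :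
  0 <= r -> p ^ 2 + q ^ 2 <= r ^ 2 -> - r <= p <= r /\ - r <= q <= r.
Proof.
  intros Hr H; pose proof (pow2_ge_0 p); pose proof (pow2_ge_0 q).
  split; apply Rabs_le_between; rewrite <- (Rabs_pos_eq r) by trivial;
    apply Rsqr_le_abs_0; unfold Rsqr; nra.
Qed.

(** For [p = x0 - a] and [q = y0 - v] the bracket is the increment of [(y - v)^2 - 2 (x - a)^2] from
    [(x0, y0)] to a point of the circle of radius [r]. The integrand bounds [B] from below around a
    minimum of the perturbed function, and the gain [k * PI * r ^ 2] contradicts the mean value
    property. *)
Lemma sub_mean_integral (B0 k p q r : R) :
  ex_RInt (fun th => B0 - k * (2 * q * (r * sin th) + (r * sin th) ^ 2
    - 4 * p * (r * cos th) - 2 * (r * cos th) ^ 2)) 0 (2 * PI) /\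
  RInt (fun th => B0 - k * (2 * q * (r * sin th) + (r * sin th) ^ 2
    - 4 * p * (r * cos th) - 2 * (r * cos th) ^ 2)) 0 (2 * PI) = 2 * PI * B0 + k * PI * r ^ 2.
Proof.
  set (g := fun th => _).
  (* An explicit antiderivative, from those of [sin^2] and [2 cos^2]. *)
  set (E := fun th => B0 * th - k * (- 2 * q * r * cos th - 4 * p * r * sin th
    + r ^ 2 * ((th - sin th * cos th) / 2 - (th + sin th * cos th)))).
  assert (HI : is_RInt g 0 (2 * PI) (minus (E (2 * PI)) (E 0))).
  { apply (@is_RInt_derive R_CompleteNormedModule E g).
    - intros th _; unfold E, g; auto_derive; trivial.
      pose proof (sin2_cos2 th) as S; unfold Rsqr in S.
      apply Rminus_diag_uniq.
      match goal with |- ?e = 0 =>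
        replace e with (- (k * r ^ 2 / 2) * (sin th * sin th + cos th * cos th - 1)) by field end.
      rewrite S; ring.
    - intros th _; apply (@ex_derive_continuous R_AbsRing R_NormedModule).
      unfold g; auto_derive; trivial. }
  split; [eexists; exact HI | ].
  rewrite (is_RInt_unique _ _ _ _ HI); unfold E, minus, plus, opp; simpl.
  rewrite cos_2PI, sin_2PI, cos_0, sin_0; field.
Qed.

(* [(y - v)^2 - 2 (x - a)^2] is strictly superharmonic, so adding a multiple of it to the harmonic
   function [B] leaves no interior minimum. *)
Lemma rect_lower_bound (A B : R -> R -> R) (a b v T c m : R) :
  a <= b -> 0 < T -> m < c ->
  (forall x y, a <= x <= b -> v - T <= y <= v + T -> cauchy_riemann A B x y) ->
  (forall y, v - T <= y <= v + T -> c <= B a y /\ c <= B b y) ->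
  (forall x, a <= x <= b -> m <= B x (v - T) /\ m <= B x (v + T)) ->
  forall x, a <= x <= b -> c - (c - m) / T ^ 2 * (2 * (b - a) ^ 2) <= B x v.
Proof.
  intros Hab HT Hmc Hcr Hside Htop x Hx.
  (* [k * T ^ 2 = c - m] makes up for the weaker bound [m] on the horizontal edges. In [f] the
     constant [2 * (b - a) ^ 2] keeps the added term nonnegative on the rectangle. *)
  set (k := (c - m) / T ^ 2).
  assert (Hk : 0 < k) by (apply Rdiv_lt_0_compat; [lra | nra]).
  assert (HkT : k * T ^ 2 = c - m) by (unfold k; field; lra).
  set (f := fun x y => B x y + k * ((y - v) * (y - v) - 2 * ((x - a) * (x - a)) + 2 * (b - a) ^ 2)).
  destruct (rect_minimum f a b (v - T) (v + T)) as [x0 [y0 [X0 [Y0 Hmin]]]]; [lra | lra | | ].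
  { intros x1 y1 H1 H2; unfold f; apply continuity_2d_pt_plus.
    - apply (cauchy_riemann_continuity A); auto.
    - repeat first [ apply continuity_2d_pt_const | apply continuity_2d_pt_id1
        | apply continuity_2d_pt_id2 | apply continuity_2d_pt_plus
        | apply continuity_2d_pt_opp | apply continuity_2d_pt_mult ]. }
  assert (Hf : c <= f x0 y0).
  { assert (Hsq : forall z, a <= z <= b -> (z - a) * (z - a) <= (b - a) ^ 2) by (intros; nra).
    assert (Hedge : x0 = a \/ x0 = b -> c <= f x0 y0).
    { intros Hor; assert (Hc : c <= B x0 y0) by (destruct Hor as [-> | ->]; now apply Hside).
      unfold f; specialize (Hsq x0 X0).
      assert (0 <= k * ((y0 - v) * (y0 - v) - 2 * ((x0 - a) * (x0 - a)) + 2 * (b - a) ^ 2)).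
      { pose proof (Rle_0_sqr (y0 - v)) as S; unfold Rsqr in S; apply Rmult_le_pos; lra. }
      lra. }
    assert (Hedge' : y0 = v - T \/ y0 = v + T -> c <= f x0 y0).
    { intros Hor; assert (Hm : m <= B x0 y0) by (destruct Hor as [-> | ->]; now apply Htop).
      unfold f; specialize (Hsq x0 X0).
      assert (k * T ^ 2 <= k * ((y0 - v) * (y0 - v) - 2 * ((x0 - a) * (x0 - a)) + 2 * (b - a) ^ 2)).
      { apply Rmult_le_compat_l; [lra | ].
        assert ((y0 - v) * (y0 - v) = T ^ 2) by (destruct Hor as [-> | ->]; ring).
        lra. }
      lra. }
    destruct (Req_dec x0 a); [auto | ]; destruct (Req_dec x0 b); [auto | ].
    destruct (Req_dec y0 (v - T)); [auto | ]; destruct (Req_dec y0 (v + T)); [auto | ].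
    exfalso.
    (* At an interior minimum, a circle inside the rectangle contradicts the mean value property. *)
    set (r := Rmin (Rmin (x0 - a) (b - x0)) (Rmin (y0 - (v - T)) (v + T - y0))).
    assert (Hr : 0 < r) by (repeat apply Rmin_pos; lra).
    assert (Hr1 : r <= x0 - a) by (eapply Rle_trans; [apply Rmin_l | apply Rmin_l]).
    assert (Hr2 : r <= b - x0) by (eapply Rle_trans; [apply Rmin_l | apply Rmin_r]).
    assert (Hr3 : r <= y0 - (v - T)) by (eapply Rle_trans; [apply Rmin_r | apply Rmin_l]).
    assert (Hr4 : r <= v + T - y0) by (eapply Rle_trans; [apply Rmin_r | apply Rmin_r]).
    clearbody r.
    destruct (circle_mean_value A B x0 y0 r Hr) as [HI HM].
    { intros x1 y1 Hd.
      destruct (disc_in_square (x1 - x0) (y1 - y0) r (Rlt_le _ _ Hr) Hd); apply Hcr; lra. }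
    destruct (sub_mean_integral (B x0 y0) k (x0 - a) (y0 - v) r) as [HI' HM'].
    pose proof PI_RGT_0.
    assert (H2PI : 0 <= 2 * PI) by lra.
    assert (Hle := RInt_le _ _ 0 (2 * PI) H2PI HI' HI).
    assert (0 < k * PI * r ^ 2) by (apply Rmult_lt_0_compat; [now apply Rmult_lt_0_compat | now apply pow_lt]).
    rewrite HM, HM' in Hle.
    enough (2 * PI * B x0 y0 + k * PI * r ^ 2 <= 2 * PI * B x0 y0) by lra.
    apply Hle; intros th _.
    assert (Hcos : - r <= r * cos th <= r) by (pose proof (COS_bound th); split; nra).
    assert (Hsin : - r <= r * sin th <= r) by (pose proof (SIN_bound th); split; nra).
    assert (Hm := Hmin (x0 + r * cos th) (y0 + r * sin th)).
    unfold f in Hm.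
    assert (K : B x0 y0 + k * ((y0 - v) * (y0 - v) - 2 * ((x0 - a) * (x0 - a)) + 2 * (b - a) ^ 2) <=
      B (x0 + r * cos th) (y0 + r * sin th) +
      k * ((y0 + r * sin th - v) * (y0 + r * sin th - v)
        - 2 * ((x0 + r * cos th - a) * (x0 + r * cos th - a)) + 2 * (b - a) ^ 2))
      by (apply Hm; split; lra).
    lra. }
  assert (Hxv := Hmin x v); unfold f in Hxv at 2.
  assert (Hxv' : c <= B x v + k * ((v - v) * (v - v) - 2 * ((x - a) * (x - a)) + 2 * (b - a) ^ 2))
    by (eapply Rle_trans; [exact Hf | apply Hxv; lra]).
  assert (0 <= k * ((x - a) * (x - a))) by (apply Rmult_le_pos; [lra | apply Rle_0_sqr]).
  lra.
Qed.

(** The width is fixed, so the loss in [rect_lower_bound] is a constant over [T ^ 2] and vanishes as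
    the rectangles grow; their centres [v] may depend on [T]. *)
Lemma strip_lower_bound (A B : R -> R -> R) (a b c m : R) :
  a <= b -> m < c ->
  (forall x y, a <= x <= b -> cauchy_riemann A B x y) ->
  (forall T, 0 < T -> exists v,
     (forall y, v - T <= y <= v + T -> c <= B a y /\ c <= B b y) /\
     (forall x, a <= x <= b -> m <= B x (v - T) /\ m <= B x (v + T))) ->
  forall x c', a <= x <= b -> c' < c -> exists v, c' <= B x v.
Proof.
  intros Hab Hmc Hcr Hv x c' Hx Hc'.
  set (K := (c - m) * (2 * (b - a) ^ 2)).
  assert (HK : 0 <= K) by (apply Rmult_le_pos; [lra | nra]).
  (* Chosen so that [T >= 1] and [K <= (c - c') * T], whence [K / T ^ 2 <= c - c']. *)
  set (T := K / (c - c') + 1).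
  assert (HT0 : 0 <= K / (c - c')) by (apply Rdiv_le_0_compat; lra).
  assert (HT : 1 <= T) by (unfold T; lra).
  assert (HKT : K / T ^ 2 <= c - c').
  { apply Rle_div_l; [nra | ].
    apply Rle_trans with ((c - c') * T); [ | apply Rmult_le_compat_l; nra].
    unfold T; rewrite Rmult_plus_distr_l; replace ((c - c') * (K / (c - c'))) with K by (field; lra).
    lra. }
  destruct (Hv T) as [v [Hside Htop]]; [lra | ].
  exists v.
  assert (H := rect_lower_bound A B a b v T c m Hab ltac:(lra) Hmc
    (fun x y Hx _ => Hcr x y Hx) Hside Htop x Hx).
  replace ((c - m) / T ^ 2 * (2 * (b - a) ^ 2)) with (K / T ^ 2) in H
    by (unfold K; field; lra).
  lra.
Qed.

Lemma IVT_continuous (f : R -> R) (a b y : R) :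
  (forall x, continuous f x) -> a <= b -> f a <= y <= f b -> exists x, a <= x <= b /\ f x = y.
Proof.
  intros Hf Hab Hy.
  destruct (IVT_gen f a b y) as [x [Hx Hfx]].
  - intros x; apply continuity_pt_filterlim, Hf.
  - split; [eapply Rle_trans; [apply Rmin_l | lra] | eapply Rle_trans; [ | apply Rmax_r]; lra].
  - exists x; rewrite Rmin_left, Rmax_right in Hx by trivial; auto.
Qed.

(* A value attained on two vertical sides is, by strict monotonicity, strictly exceeded high up and
   strictly undercut low down on both, hence also in between. *)
Lemma strip_level_interval (A B : R -> R -> R) (a b y0 va vb x : R) :
  a <= x <= b ->
  (forall x y, a <= x <= b -> cauchy_riemann A B x y) ->
  (forall x y y', a <= x <= b -> y < y' -> B x y < B x y') ->
  B a va = y0 -> B b vb = y0 -> exists v, B x v = y0.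
Proof.
  intros Hx Hcr Hinc Ha Hb.
  assert (Hinc' : forall x y y', a <= x <= b -> y <= y' -> B x y <= B x y').
  { intros x1 y y' H1 [H2 | ->]; [left; auto | lra]. }
  assert (Hcont : forall x y, a <= x <= b -> continuity_2d_pt B x y).
  { intros; apply (cauchy_riemann_continuity A); auto. }
  assert (Hup : exists v, y0 <= B x v).
  (* At height [V], strictly above both [va] and [vb], strict monotonicity puts [B] above [y0] on
     both sides. *)
  { set (V := Rmax va vb + 1).
    assert (H1 : va < V) by (unfold V; pose proof (Rmax_l va vb); lra).
    assert (H2 : vb < V) by (unfold V; pose proof (Rmax_r va vb); lra).
    set (c := Rmin (B a V) (B b V)).
    assert (Hc1 : c <= B a V) by apply Rmin_l.
    assert (Hc2 : c <= B b V) by apply Rmin_r.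
    assert (Hc : y0 < c).
    { apply Rmin_glb_lt; [rewrite <- Ha | rewrite <- Hb]; apply Hinc; lra. }
    (* A degenerate rectangle: the minimum on the segment at height [V] bounds [B] below everywhere
       above it. Subtracting 1 from [c] below ensures [m < c]. *)
    destruct (rect_minimum B a b V V) as [x0 [y1 [X0 [Y1 Hmin]]]]; [lra | lra | auto | ].
    apply (strip_lower_bound A B a b c (Rmin (B x0 y1) (c - 1))); trivial; [lra | | ].
    - pose proof (Rmin_r (B x0 y1) (c - 1)); lra.
    (* Centred at [V + T], the rectangle of half height [T] starts at height [V]. *)
    - intros T HT; exists (V + T); split.
      + intros y Hy; split; [apply (Rle_trans _ _ _ Hc1) | apply (Rle_trans _ _ _ Hc2)]; apply Hinc'; lra.
      + intros x1 Hx1; assert (Hm : B x0 y1 <= B x1 V) by (apply Hmin; lra).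
        split; (eapply Rle_trans; [apply Rmin_l | ]);
          (eapply Rle_trans; [exact Hm | apply Hinc'; lra]). }
  assert (Hlow : exists v, B x v <= y0).
  (* The same argument for [- A] and [- B], going downwards from below [va] and [vb]. *)
  { enough (H : exists v, - y0 <= - B x v) by (destruct H as [v H]; exists v; lra).
    set (V := Rmin va vb - 1).
    assert (H1 : V < va) by (unfold V; pose proof (Rmin_l va vb); lra).
    assert (H2 : V < vb) by (unfold V; pose proof (Rmin_r va vb); lra).
    set (c := Rmin (- B a V) (- B b V)).
    assert (Hc1 : c <= - B a V) by apply Rmin_l.
    assert (Hc2 : c <= - B b V) by apply Rmin_r.
    assert (Hc : - y0 < c).
    { apply Rmin_glb_lt; apply Ropp_lt_contravar; [rewrite <- Ha | rewrite <- Hb];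
        apply Hinc; lra. }
    destruct (rect_minimum (fun x y => - B x y) a b V V) as [x0 [y1 [X0 [Y1 Hmin]]]];
      [lra | lra | intros; apply continuity_2d_pt_opp; auto | ].
    apply (strip_lower_bound (fun x y => - A x y) (fun x y => - B x y) a b c
      (Rmin (- B x0 y1) (c - 1))); trivial; [lra | | | ].
    - pose proof (Rmin_r (- B x0 y1) (c - 1)); lra.
    - intros x1 y Hx1; destruct (Hcr x1 y Hx1) as [p [q [HA HB]]].
      exists (- p), (- q); split;
        [ assert (H := differentiable_pt_lim_lin _ _ (-1) 0 0 _ _ _ _ _ _ HA HA)
        | assert (H := differentiable_pt_lim_lin _ _ (-1) 0 0 _ _ _ _ _ _ HB HB) ];
        (eapply differentiable_pt_lim_eq;
          [ eapply differentiable_pt_lim_ext; [ | exact H] | ring | ring ]);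
        exists (mkposreal _ Rlt_0_1); intros; ring.
    - intros T HT; exists (V - T); split.
      + intros y Hy; split; [apply (Rle_trans _ _ _ Hc1) | apply (Rle_trans _ _ _ Hc2)];
          apply Ropp_le_contravar, Hinc'; lra.
      + intros x1 Hx1; assert (Hm : - B x0 y1 <= - B x1 V) by (apply Hmin; lra).
        split; (eapply Rle_trans; [apply Rmin_l | ]);
          (eapply Rle_trans; [exact Hm | apply Ropp_le_contravar, Hinc'; lra]). }
  destruct Hup as [v2 Hv2]; destruct Hlow as [v1 Hv1].
  destruct (Rle_dec v1 v2) as [Hle | Hgt].
  - destruct (IVT_continuous (fun v => B x v) v1 v2 y0) as [v [_ Hv]]; [ | lra | lra | now exists v].
    intros v; apply (continuity_2d_slices B x v); auto.
  (* This order of the heights contradicts monotonicity. *)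
  - exists v1; pose proof (Hinc x v2 v1 Hx); lra.
Qed.

(** * Complex modulus and complex differentiability *)

Definition normsq (z : Cplx) : R := fst z * fst z + snd z * snd z.

Lemma normsq_Cmul (z w : Cplx) : normsq (Cmul z w) = normsq z * normsq w.
Proof. unfold normsq, Cmul; simpl; ring. Qed.

Lemma normsq_ge_0 (z : Cplx) : 0 <= normsq z.
Proof. unfold normsq; nra. Qed.

Lemma normsq_pos (z : Cplx) : z <> Czero -> 0 < normsq z.
Proof.
  intros Hz; destruct (normsq_ge_0 z) as [H | H]; trivial.
  exfalso; apply Hz; destruct z as [x y]; unfold normsq in H; simpl in H.
  unfold Czero; f_equal; nra.
Qed.

Lemma Cnorm_lt_1 (z : Cplx) : Cnorm z < 1 <-> normsq z < 1.
Proof.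
  unfold Cnorm; fold (normsq z); split; intros H.
  - apply sqrt_lt_0_alt; now rewrite sqrt_1.
  - rewrite <- sqrt_1; apply sqrt_lt_1_alt; split; [apply normsq_ge_0 | exact H].
Qed.

Lemma Cnorm_Cdiv_lt_1 (z w : Cplx) :
  w <> Czero -> Cnorm (Cdiv z w) < 1 <-> normsq z < normsq w.
Proof.
  intros Hw; apply normsq_pos in Hw.
  rewrite Cnorm_lt_1; unfold Cdiv; rewrite normsq_Cmul.
  replace (normsq (Cinv w)) with (/ normsq w)
    by (unfold Cinv; fold (normsq w); unfold normsq at 2; simpl; unfold normsq in *; field; lra).
  split; intros H.
  - apply (Rmult_lt_compat_r (normsq w)) in H; trivial.
    rewrite Rmult_assoc, Rinv_l in H; lra.
  - apply (Rmult_lt_reg_r (normsq w)); trivial.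
    rewrite Rmult_assoc, Rinv_l; lra.
Qed.

Lemma Rabs_fst_le_Cnorm (z : Cplx) : Rabs (fst z) <= Cnorm z.
Proof.
  rewrite <- sqrt_Rsqr_abs; apply sqrt_le_1_alt; unfold Rsqr; nra.
Qed.

Lemma Rabs_snd_le_Cnorm (z : Cplx) : Rabs (snd z) <= Cnorm z.
Proof.
  rewrite <- sqrt_Rsqr_abs; apply sqrt_le_1_alt; unfold Rsqr; nra.
Qed.

Lemma Cnorm_le_Rabs_sum (z : Cplx) : Cnorm z <= Rabs (fst z) + Rabs (snd z).
Proof.
  pose proof (Rabs_pos (fst z)); pose proof (Rabs_pos (snd z)).
  rewrite <- (sqrt_Rsqr (Rabs (fst z) + Rabs (snd z))) by lra.
  apply sqrt_le_1_alt.
  rewrite <- (Rabs_pos_eq (fst z * fst z)), <- (Rabs_pos_eq (snd z * snd z)) by nra.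
  rewrite !Rabs_mult; unfold Rsqr; nra.
Qed.

(** The remainders of the two real differentials are the real and imaginary parts of the complex
    remainder. The modulus and the maximum norm agree up to a factor 2, hence the halved [eps]. *)
Lemma has_complex_deriv_iff (F : Cplx -> Cplx) (x y : R) (d : Cplx) :
  has_complex_deriv F (x, y) d <->
  differentiable_pt_lim (fun u v => fst (F (u, v))) x y (fst d) (- snd d) /\
  differentiable_pt_lim (fun u v => snd (F (u, v))) x y (snd d) (fst d).
Proof.
  set (rem := fun u v => Csub (Csub (F (u, v)) (F (x, y))) (Cmul d (Csub (u, v) (x, y)))).
  assert (R1 : forall u v, fst (F (u, v)) - fst (F (x, y)) -
    (fst d * (u - x) + - snd d * (v - y)) = fst (rem u v)).
  { intros; unfold rem, Csub, Cmul; simpl; ring. }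
  assert (R2 : forall u v, snd (F (u, v)) - snd (F (x, y)) -
    (snd d * (u - x) + fst d * (v - y)) = snd (rem u v)).
  { intros; unfold rem, Csub, Cmul; simpl; ring. }
  split.
  - intros H.
    enough (K : forall eps : posreal, locally_2d (fun u v =>
      Cnorm (rem u v) <= eps * Rmax (Rabs (u - x)) (Rabs (v - y))) x y).
    { split; intros eps; destruct (K eps) as [delta Hd]; exists delta; intros u v Hu Hv;
        [rewrite R1 | rewrite R2]; (eapply Rle_trans; [ | apply Hd; eauto]);
        [apply Rabs_fst_le_Cnorm | apply Rabs_snd_le_Cnorm]. }
    intros [eps Heps].
    destruct (H (eps / 2)) as [delta [Hdelta Hd]]; [lra | ].
    assert (Hdelta2 : 0 < delta / 2) by lra.
    exists (mkposreal _ Hdelta2); simpl; intros u v Hu Hv.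
    assert (N := Cnorm_le_Rabs_sum (Csub (u, v) (x, y))).
    assert (N1 := Rabs_fst_le_Cnorm (Csub (u, v) (x, y))).
    assert (N2 := Rabs_snd_le_Cnorm (Csub (u, v) (x, y))).
    simpl in N, N1, N2.
    pose proof (Rmax_l (Rabs (u - x)) (Rabs (v - y))).
    pose proof (Rmax_r (Rabs (u - x)) (Rabs (v - y))).
    pose proof (Rabs_pos (u - x)); pose proof (Rabs_pos (v - y)).
    destruct (Rlt_dec 0 (Cnorm (Csub (u, v) (x, y)))) as [Hpos | Hzero].
    + eapply Rle_trans; [apply (Hd (u, v)); lra | ].
      apply Rle_trans with (eps / 2 * (2 * Rmax (Rabs (u - x)) (Rabs (v - y)))); [ | lra].
      apply Rmult_le_compat_l; lra.
    (* [has_complex_deriv] is silent at the point itself, where the remainder vanishes. *)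
    + assert (Rabs (u - x) = 0) as E1%Rabs_eq_0 by lra.
      assert (Rabs (v - y) = 0) as E2%Rabs_eq_0 by lra.
      replace u with x by lra; replace v with y by lra.
      eapply Rle_trans; [apply Cnorm_le_Rabs_sum | ].
      rewrite <- R1, <- R2, !Rminus_diag, !Rmult_0_r, Rplus_0_r, Rminus_0_r, Rabs_R0.
      rewrite Rmax_left by lra; lra.
  - intros [H1 H2] eps Heps.
    assert (He : 0 < eps / 2) by lra.
    destruct (H1 (mkposreal _ He)) as [[d1 Hd1] K1].
    destruct (H2 (mkposreal _ He)) as [[d2 Hd2] K2]; simpl in K1, K2.
    exists (Rmin d1 d2); split; [now apply Rmin_pos | ].
    intros [u v] [_ Hw].
    assert (N1 := Rabs_fst_le_Cnorm (Csub (u, v) (x, y))).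
    assert (N2 := Rabs_snd_le_Cnorm (Csub (u, v) (x, y))).
    simpl in N1, N2.
    pose proof (Rmin_l d1 d2); pose proof (Rmin_r d1 d2).
    specialize (K1 u v ltac:(lra) ltac:(lra)); specialize (K2 u v ltac:(lra) ltac:(lra)).
    rewrite R1 in K1; rewrite R2 in K2.
    assert (M : eps / 2 * Rmax (Rabs (u - x)) (Rabs (v - y)) <= eps / 2 * Cnorm (Csub (u, v) (x, y))).
    { apply Rmult_le_compat_l; [lra | ]; now apply Rmax_lub. }
    eapply Rle_trans; [apply Cnorm_le_Rabs_sum | ]; fold (rem u v); lra.
Qed.

Lemma has_complex_deriv_combination (F G : Cplx -> Cplx) (s t : R) (z dF dG : Cplx) :
  has_complex_deriv F z dF -> has_complex_deriv G z dG ->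
  has_complex_deriv (fun w => Cadd (Cscale s (F w)) (Cscale t (G w))) z
    (Cadd (Cscale s dF) (Cscale t dG)).
Proof.
  destruct z as [x y]; rewrite !has_complex_deriv_iff; intros [F1 F2] [G1 G2]; split.
  - assert (H := differentiable_pt_lim_lin _ _ s t 0 _ _ _ _ _ _ F1 G1).
    eapply differentiable_pt_lim_eq.
    + eapply differentiable_pt_lim_ext; [ | exact H].
      exists (mkposreal _ Rlt_0_1); intros; simpl; ring.
    + reflexivity.
    + simpl; ring.
  - assert (H := differentiable_pt_lim_lin _ _ s t 0 _ _ _ _ _ _ F2 G2).
    eapply differentiable_pt_lim_eq.
    + eapply differentiable_pt_lim_ext; [ | exact H].
      exists (mkposreal _ Rlt_0_1); intros; simpl; ring.
    + reflexivity.
    + reflexivity.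
Qed.

(** * The half-plane coordinate on the disc *)

(* The inverse [w / (1 + w)] of the half-plane map [z / (1 - z)], at [w = u + i v]. *)
Definition to_disc (u v : R) : Cplx :=
  let n := (1 + u) * (1 + u) + v * v in (1 - (1 + u) / n, v / n).

(** This is [1 / (1 + w) ^ 2], with [n = |1 + w| ^ 2]. *)
Definition to_disc_deriv (u v : R) : Cplx :=
  let n := (1 + u) * (1 + u) + v * v in
  (((1 + u) * (1 + u) - v * v) / (n * n), - (2 * (1 + u) * v) / (n * n)).

Definition half_plane_map (z : Cplx) : Cplx := Cdiv z (Csub Cone z).

Lemma to_disc_denom_pos (u v : R) : - (1 / 2) < u -> 0 < (1 + u) * (1 + u) + v * v.
Proof. nra. Qed.

Lemma to_disc_inE (u v : R) : - (1 / 2) < u -> inE (to_disc u v).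
Proof.
  intros Hu; pose proof (to_disc_denom_pos u v Hu) as Hn.
  apply Cnorm_lt_1; unfold normsq, to_disc; simpl.
  set (n := (1 + u) * (1 + u) + v * v) in *.
  replace ((1 - (1 + u) / n) * (1 - (1 + u) / n) + v / n * (v / n)) with (1 - (1 + 2 * u) / n)
    by (unfold n; field; fold n; lra).
  assert (0 < (1 + 2 * u) / n) by (apply Rdiv_lt_0_compat; lra); lra.
Qed.

Lemma half_plane_map_to_disc (u v : R) :
  - (1 / 2) < u -> half_plane_map (to_disc u v) = (u, v).
Proof.
  intros Hu; pose proof (to_disc_denom_pos u v Hu) as Hn.
  unfold half_plane_map, Cdiv, Cinv, Cmul, Csub, Cone, to_disc; simpl.
  set (n := (1 + u) * (1 + u) + v * v) in *.
  assert (E : (1 - (1 - (1 + u) / n)) * (1 - (1 - (1 + u) / n)) + (0 - v / n) * (0 - v / n) = / n)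
    by (unfold n; field; fold n; lra).
  rewrite E; f_equal; unfold n; field; fold n; lra.
Qed.

Lemma disc_parametrized (z : Cplx) :
  inE z -> exists u v, - (1 / 2) < u /\ z = to_disc u v.
Proof.
  intros Hz; apply Cnorm_lt_1 in Hz; destruct z as [x y]; unfold normsq in Hz; simpl in Hz.
  set (e := (1 - x) * (1 - x) + y * y).
  assert (He : 0 < e) by (unfold e; nra).
  (* The coordinate is [z / (1 - z) = 1 / (1 - z) - 1], with [e = |1 - z| ^ 2]. *)
  exists ((1 - x) / e - 1), (y / e); split.
  - apply (Rmult_lt_reg_r e); trivial.
    replace (((1 - x) / e - 1) * e) with (1 - x - e) by (field; lra); unfold e; lra.
  - unfold to_disc.
    replace (1 + ((1 - x) / e - 1)) with ((1 - x) / e) by ring.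
    replace ((1 - x) / e * ((1 - x) / e) + y / e * (y / e)) with (/ e)
      by (unfold e; field; fold e; lra).
    f_equal; field; lra.
Qed.

Lemma differentiable_to_disc (u v : R) :
  - (1 / 2) < u ->
  differentiable_pt_lim (fun u v => fst (to_disc u v)) u v
    (fst (to_disc_deriv u v)) (- snd (to_disc_deriv u v)) /\
  differentiable_pt_lim (fun u v => snd (to_disc u v)) u v
    (snd (to_disc_deriv u v)) (fst (to_disc_deriv u v)).
Proof.
  intros Hu; pose proof (to_disc_denom_pos u v Hu) as Hn.
  assert (Hid : differentiable_pt_lim (fun p _ : R => 1 + p) u v 1 0).
  { apply (differentiable_pt_lim_proj1_0 (fun p => 1 + p)), is_derive_Reals; auto_derive; trivial. }
  assert (Hsn : differentiable_pt_lim (fun _ q : R => q) u v 0 1).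
  { apply (differentiable_pt_lim_snd (fun q => q)), derivable_pt_lim_id. }
  assert (Hnum : differentiable_pt_lim (fun p q => 1 * ((1 + p) * (1 + p)) + 1 * (q * q) + 0) u v
    (1 * ((1 + u) * 1 + (1 + u) * 1) + 1 * (v * 0 + v * 0))
    (1 * ((1 + u) * 0 + (1 + u) * 0) + 1 * (v * 1 + v * 1))).
  { apply differentiable_pt_lim_lin.
    - exact (differentiable_pt_lim_mult _ _ _ _ _ _ _ _ Hid Hid).
    - exact (differentiable_pt_lim_mult _ _ _ _ _ _ _ _ Hsn Hsn). }
  set (n := (1 + u) * (1 + u) + v * v) in *.
  (* The reciprocal gets a dummy second argument, later filled by the zero function, to fit the
     two-variable chain rule. *)
  assert (Hinv : differentiable_pt_lim (fun s _ : R => / s)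
    (1 * ((1 + u) * (1 + u)) + 1 * (v * v) + 0) 0 (- 1 / n ^ 2) 0).
  { replace (1 * ((1 + u) * (1 + u)) + 1 * (v * v) + 0) with n by (unfold n; ring).
    apply differentiable_pt_lim_proj1_0, is_derive_Reals; auto_derive; [lra | field; lra]. }
  assert (Hzero : differentiable_pt_lim (fun _ _ : R => 0) u v 0 0).
  { apply (differentiable_pt_lim_proj1_0 (fun _ => 0)), is_derive_Reals; auto_derive; trivial. }
  assert (Hi := differentiable_pt_lim_comp _ _ _ _ _ _ _ _ _ _ _ Hinv Hnum Hzero).
  assert (H1 := differentiable_pt_lim_mult _ _ _ _ _ _ _ _ Hid Hi).
  assert (H2 := differentiable_pt_lim_mult _ _ _ _ _ _ _ _ Hsn Hi).
  cbv beta in H1, H2.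
  replace (1 * ((1 + u) * (1 + u)) + 1 * (v * v) + 0) with n in H1, H2 by (unfold n; ring).
  split.
  - assert (H1' := differentiable_pt_lim_lin _ _ (-1) 0 1 _ _ _ _ _ _ H1 H1).
    eapply differentiable_pt_lim_eq.
    + eapply differentiable_pt_lim_ext; [ | exact H1'].
      exists (mkposreal _ Rlt_0_1); intros p q _ _; unfold to_disc; simpl.
      replace (1 * ((1 + p) * (1 + p)) + 1 * (q * q) + 0) with ((1 + p) * (1 + p) + q * q) by ring.
      unfold Rdiv; ring.
    + unfold to_disc_deriv; simpl; fold n; unfold n; field; fold n; lra.
    + unfold to_disc_deriv; simpl; fold n; unfold n; field; fold n; lra.
  - eapply differentiable_pt_lim_eq.
    + eapply differentiable_pt_lim_ext; [ | exact H2].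
      exists (mkposreal _ Rlt_0_1); intros p q _ _; unfold to_disc; simpl.
      replace (1 * ((1 + p) * (1 + p)) + 1 * (q * q) + 0) with ((1 + p) * (1 + p) + q * q) by ring.
      unfold Rdiv; ring.
    + unfold to_disc_deriv; simpl; fold n; unfold n; field; fold n; lra.
    + unfold to_disc_deriv; simpl; fold n; unfold n; field; fold n; lra.
Qed.

Lemma differentiable_comp_to_disc (F : Cplx -> Cplx) (u v : R) (d : Cplx) :
  - (1 / 2) < u -> has_complex_deriv F (to_disc u v) d ->
  differentiable_pt_lim (fun u v => fst (F (to_disc u v))) u v
    (fst (Cmul d (to_disc_deriv u v))) (- snd (Cmul d (to_disc_deriv u v))) /\
  differentiable_pt_lim (fun u v => snd (F (to_disc u v))) u v
    (snd (Cmul d (to_disc_deriv u v))) (fst (Cmul d (to_disc_deriv u v))).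
Proof.
  intros Hu HF; destruct (differentiable_to_disc u v Hu) as [D1 D2].
  apply has_complex_deriv_iff in HF; destruct HF as [F1 F2].
  split.
  - eapply differentiable_pt_lim_eq.
    + exact (differentiable_pt_lim_comp (fun p q => fst (F (p, q))) (fun p q => fst (to_disc p q))
        (fun p q => snd (to_disc p q)) u v _ _ _ _ _ _ F1 D1 D2).
    + unfold Cmul; simpl; ring.
    + unfold Cmul; simpl; ring.
  - eapply differentiable_pt_lim_eq.
    + exact (differentiable_pt_lim_comp (fun p q => snd (F (p, q))) (fun p q => fst (to_disc p q))
        (fun p q => snd (to_disc p q)) u v _ _ _ _ _ _ F2 D1 D2).
    + unfold Cmul; simpl; ring.
    + unfold Cmul; simpl; ring.
Qed.

Lemma locally_half_plane (P : R -> R -> Prop) (u v : R) :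
  - (1 / 2) < u -> (forall p q, - (1 / 2) < p -> P p q) -> locally_2d P u v.
Proof.
  intros Hu HP; assert (Hd : 0 < u + 1 / 2) by lra.
  exists (mkposreal _ Hd); simpl; intros p q Hp _; apply HP.
  apply Rabs_def2 in Hp; lra.
Qed.

(** Differentiate [h + g = w] in the coordinate [w]. The imaginary part suffices: its two partial
    derivatives are the imaginary and real parts of the complex derivative. *)
Lemma deriv_sum_half_plane_map (h g : Cplx -> Cplx) (u v : R) (dh dg : Cplx) :
  (forall z, inE z -> Cadd (h z) (g z) = half_plane_map z) -> - (1 / 2) < u ->
  has_complex_deriv h (to_disc u v) dh -> has_complex_deriv g (to_disc u v) dg ->
  Cadd (Cmul dh (to_disc_deriv u v)) (Cmul dg (to_disc_deriv u v)) = Cone.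
Proof.
  intros Hsum Hu Hh Hg.
  destruct (differentiable_comp_to_disc h u v dh Hu Hh) as [_ H2].
  destruct (differentiable_comp_to_disc g u v dg Hu Hg) as [_ G2].
  assert (L := differentiable_pt_lim_lin _ _ 1 1 0 _ _ _ _ _ _ H2 G2).
  assert (L' : differentiable_pt_lim (fun _ q : R => q) u v 0 1).
  { apply (differentiable_pt_lim_snd (fun q => q)), derivable_pt_lim_id. }
  eapply (differentiable_pt_lim_ext _ (fun _ q : R => q)) in L.
  - apply differentiable_pt_lim_unique in L; apply differentiable_pt_lim_unique in L'.
    destruct L as [L1 L2]; destruct L' as [L1' L2'].
    rewrite L1 in L1'; rewrite L2 in L2'.
    unfold Cadd, Cone; f_equal; lra.
  - apply locally_half_plane; trivial; intros p q Hp.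
    assert (E := Hsum _ (to_disc_inE p q Hp)).
    rewrite half_plane_map_to_disc in E by trivial.
    apply (f_equal snd) in E; simpl in E; lra.
Qed.

(* With [a = h' * D] and [b = g' * D] for [D] the derivative of [to_disc], one has [a + b = 1], so
   [|b| < |a|] is the condition [Re a > 1/2], which is stable under convex combinations. *)
Lemma dilatation_iff (h g : Cplx -> Cplx) (u v : R) (dh dg : Cplx) :
  (forall z, inE z -> Cadd (h z) (g z) = half_plane_map z) -> - (1 / 2) < u ->
  has_complex_deriv h (to_disc u v) dh -> has_complex_deriv g (to_disc u v) dg ->
  normsq dg < normsq dh <-> 1 / 2 < fst (Cmul dh (to_disc_deriv u v)).
Proof.
  intros Hsum Hu Hh Hg.
  assert (E := deriv_sum_half_plane_map h g u v dh dg Hsum Hu Hh Hg).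
  assert (HD : 0 < normsq (to_disc_deriv u v)).
  { pose proof (to_disc_denom_pos u v Hu) as Hn.
    replace (normsq (to_disc_deriv u v)) with (/ (((1 + u) * (1 + u) + v * v) ^ 2)).
    - apply Rinv_0_lt_compat, pow_lt, Hn.
    - unfold normsq, to_disc_deriv; simpl; field; lra. }
  assert (Eh := normsq_Cmul dh (to_disc_deriv u v)).
  assert (Eg := normsq_Cmul dg (to_disc_deriv u v)).
  set (D := to_disc_deriv u v) in *.
  set (a := Cmul dh D) in *; set (b := Cmul dg D) in *; clearbody a b.
  assert (E1 := f_equal fst E); assert (E2 := f_equal snd E).
  unfold Cadd, Cone in E1, E2; simpl in E1, E2.
  assert (Eab : normsq a - normsq b = 2 * fst a - 1).
  { unfold normsq; replace (fst b) with (1 - fst a) by lra.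
    replace (snd b) with (- snd a) by lra; ring. }
  split; intros H.
  - apply (Rmult_lt_compat_r _ _ _ HD) in H; lra.
  - apply (Rmult_lt_reg_r _ _ _ HD); lra.
Qed.

(** * Univalence and convexity in the half-plane coordinate *)

Lemma harm_to_disc (h g : Cplx -> Cplx) (u v : R) :
  (forall z, inE z -> Cadd (h z) (g z) = half_plane_map z) -> - (1 / 2) < u ->
  harm h g (to_disc u v) = (u, 2 * snd (h (to_disc u v)) - v).
Proof.
  intros Hsum Hu; assert (E := Hsum _ (to_disc_inE u v Hu)).
  rewrite half_plane_map_to_disc in E by trivial.
  assert (E1 := f_equal fst E); assert (E2 := f_equal snd E); simpl in E1, E2.
  unfold harm, Cadd, Cconj; simpl; f_equal; lra.
Qed.

Lemma harm_half_plane_convex (h g h' : Cplx -> Cplx) :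
  (forall z, inE z -> Cadd (h z) (g z) = half_plane_map z) ->
  analytic_on_E_with h h' ->
  (forall u v, - (1 / 2) < u -> 1 / 2 < fst (Cmul (h' (to_disc u v)) (to_disc_deriv u v))) ->
  (forall z w, inE z -> inE w -> harm h g z = harm h g w -> z = w) /\
  convex_in_direction (image_E (harm h g)) 0 /\
  convex_in_direction (image_E (harm h g)) (0 + PI / 2).
Proof.
  intros Hsum Hh Hre.
  (* [A + i B] is [2 h - w], written in the shape produced by [differentiable_pt_lim_lin]. *)
  set (A := fun u v => 2 * fst (h (to_disc u v)) + -1 * u + 0).
  set (B := fun u v => 2 * snd (h (to_disc u v)) + -1 * v + 0).
  assert (Hf : forall u v, - (1 / 2) < u -> harm h g (to_disc u v) = (u, B u v)).
  { intros u v Hu; rewrite harm_to_disc by trivial; unfold B; f_equal; ring. }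
  (* The image lies over [u > -1/2], and its fibre over [u] is the range of [B u]. *)
  assert (Himage : forall w, image_E (harm h g) w <->
    - (1 / 2) < fst w /\ exists v, B (fst w) v = snd w).
  { intros [p q]; split.
    - intros [z [Hz <-]]; destruct (disc_parametrized z Hz) as [u [v [Hu ->]]].
      rewrite Hf by trivial; simpl; split; [trivial | now exists v].
    - simpl; intros [Hp [v <-]]; exists (to_disc p v); split.
      + now apply to_disc_inE.
      + now apply Hf. }
  assert (Hid1 : forall u v, differentiable_pt_lim (fun p _ : R => p) u v 1 0).
  { intros; apply (differentiable_pt_lim_proj1_0 (fun p => p)), derivable_pt_lim_id. }
  assert (Hid2 : forall u v, differentiable_pt_lim (fun _ q : R => q) u v 0 1).
  { intros; apply (differentiable_pt_lim_snd (fun q => q)), derivable_pt_lim_id. }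
  assert (Hderiv : forall u v, - (1 / 2) < u -> exists a b, 0 < a /\
    differentiable_pt_lim A u v a (- b) /\ differentiable_pt_lim B u v b a).
  { intros u v Hu.
    destruct (differentiable_comp_to_disc h u v _ Hu (Hh _ (to_disc_inE u v Hu))) as [D1 D2].
    specialize (Hre u v Hu).
    set (a := Cmul (h' (to_disc u v)) (to_disc_deriv u v)) in *.
    exists (2 * fst a - 1), (2 * snd a); split; [lra | ]; split.
    - eapply differentiable_pt_lim_eq.
      + exact (differentiable_pt_lim_lin _ _ 2 (-1) 0 _ _ _ _ _ _ D1 (Hid1 u v)).
      + ring.
      + ring.
    - eapply differentiable_pt_lim_eq.
      + exact (differentiable_pt_lim_lin _ _ 2 (-1) 0 _ _ _ _ _ _ D2 (Hid2 u v)).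
      + ring.
      + ring. }
  assert (Hcr : forall u v, - (1 / 2) < u -> cauchy_riemann A B u v).
  { intros u v Hu; destruct (Hderiv u v Hu) as [a [b [_ H]]]; now exists a, b. }
  assert (Hcont : forall u v, - (1 / 2) < u -> continuous (fun v => B u v) v).
  { intros u v Hu; apply (continuity_2d_slices B u v), (cauchy_riemann_continuity A); auto. }
  (* The partial derivative of [B] in [v] is [2 Re (dh/dw) - 1], which is positive. *)
  assert (Hinc : forall u v v', - (1 / 2) < u -> v < v' -> B u v < B u v').
  { intros u v v' Hu Hv.
    assert (Hpos : forall q, 0 < Derive (B u) q /\ is_derive (B u) q (Derive (B u) q)).
    { intros q; destruct (Hderiv u q Hu) as [a [b [Ha [_ HB]]]].
      assert (Hd : is_derive (B u) q a).
      { apply is_derive_Reals.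
        assert (L := derivable_pt_lim_comp_2d B (fun _ => u) (fun s => s) q _ _ _ _ HB
          (derivable_pt_lim_const u q) (derivable_pt_lim_id q)).
        now replace (b * 0 + a * 1) with a in L by ring. }
      rewrite (is_derive_unique _ _ _ Hd); auto. }
    apply (incr_function (B u) m_infty p_infty (Derive (B u))); simpl; trivial;
      intros q _ _; apply Hpos. }
  split; [ | split].
  - intros z w Hz Hw E.
    destruct (disc_parametrized z Hz) as [u [v [Hu ->]]].
    destruct (disc_parametrized w Hw) as [u' [v' [Hu' ->]]].
    rewrite !Hf in E by trivial; injection E as <- E.
    destruct (Rtotal_order v v') as [Hlt | [-> | Hgt]]; trivial.
    + pose proof (Hinc u v v' Hu Hlt); lra.
    + pose proof (Hinc u v' v Hu Hgt); lra.
  - intros [p q] s1 s2 s; rewrite !Himage; simpl; rewrite cos_0, sin_0, !Rmult_1_r, !Rmult_0_r.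
    intros [P1 [v1 E1]] [P2 [v2 E2]] Hs; split; [lra | ].
    (* The level [q] is attained on the lines [u = p + s1] and [u = p + s2], and the strip between
       them stays in the half plane. *)
    apply (strip_level_interval A B (p + s1) (p + s2) (q + 0) v1 v2); trivial; [lra | | ].
    + intros u v Hu; apply Hcr; lra.
    + intros u v v' Hu; apply Hinc; lra.
  - intros [p q] s1 s2 s; rewrite !Himage; simpl.
    rewrite Rplus_0_l, cos_PI2, sin_PI2, !Rmult_1_r, !Rmult_0_r, Rplus_0_r.
    intros [P1 [v1 E1]] [P2 [v2 E2]] Hs; split; trivial.
    (* On a vertical line the image is the range of the continuous function [B p]. *)
    destruct (Rle_dec v1 v2) as [Hle | Hgt].
    + destruct (IVT_continuous (B p) v1 v2 (q + s)) as [v [_ Hv]]; auto; [lra | now exists v].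
    + exists v1; pose proof (Hinc p v2 v1 P1); lra.
Qed.

(** * Convex combinations of the two maps *)

Lemma convex_in_direction_ext (f f' : Cplx -> Cplx) (phi : R) :
  (forall z, f z = f' z) ->
  convex_in_direction (image_E f) phi -> convex_in_direction (image_E f') phi.
Proof.
  intros E H.
  assert (HI : forall w, image_E f w <-> image_E f' w).
  { intros w; split; intros [z [Hz Hw]]; exists z; split; trivial; [rewrite <- E | rewrite E]; trivial. }
  intros a s1 s2 s; rewrite <- !HI; apply H.
Qed.

Theorem theorem2p5 (h1 g1 h2 g2 : Cplx -> Cplx) :
  SH_decomp h1 g1 ->
  SH_decomp h2 g2 ->
  (forall z, inE z -> Cadd (h1 z) (g1 z) = Cdiv z (Csub Cone z)) ->
  (forall z, inE z -> Cadd (h2 z) (g2 z) = Cdiv z (Csub Cone z)) ->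
  forall t : R, 0 <= t <= 1 ->
    in_COD_H 0 (fun z => Cadd (Cscale t (harm h1 g1 z)) (Cscale (1 - t) (harm h2 g2 z))).
Proof.
  intros [h1' [g1' [Hh1 [Hg1 [Hn1 [Hd1 [_ [H01 H11]]]]]]]].
  intros [h2' [g2' [Hh2 [Hg2 [Hn2 [Hd2 [_ [H02 H12]]]]]]]] Hs1 Hs2 t Ht.
  set (mix := fun (F G : Cplx -> Cplx) z => Cadd (Cscale t (F z)) (Cscale (1 - t) (G z))).
  assert (Hmix : forall z, Cadd (Cscale t (harm h1 g1 z)) (Cscale (1 - t) (harm h2 g2 z)) =
    harm (mix h1 h2) (mix g1 g2) z).
  { intros z; unfold harm, mix, Cadd, Cscale, Cconj; simpl; f_equal; ring. }
  assert (Hh : analytic_on_E_with (mix h1 h2) (mix h1' h2')).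
  { intros z Hz; apply has_complex_deriv_combination; auto. }
  assert (Hg : analytic_on_E_with (mix g1 g2) (mix g1' g2')).
  { intros z Hz; apply has_complex_deriv_combination; auto. }
  assert (Hs : forall z, inE z -> Cadd (mix h1 h2 z) (mix g1 g2 z) = half_plane_map z).
  { intros z Hz.
    transitivity (Cadd (Cscale t (Cadd (h1 z) (g1 z))) (Cscale (1 - t) (Cadd (h2 z) (g2 z)))).
    - unfold mix, Cadd, Cscale; simpl; f_equal; ring.
    - rewrite Hs1, Hs2 by trivial; fold (half_plane_map z).
      unfold Cadd, Cscale; destruct (half_plane_map z) as [x y]; simpl; f_equal; ring. }
  assert (Hre : forall u v, - (1 / 2) < u ->
    1 / 2 < fst (Cmul (mix h1' h2' (to_disc u v)) (to_disc_deriv u v))).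
  { intros u v Hu; assert (Hz := to_disc_inE u v Hu).
    assert (R1 : 1 / 2 < fst (Cmul (h1' (to_disc u v)) (to_disc_deriv u v))).
    { apply (dilatation_iff h1 g1 u v _ _ Hs1 Hu (Hh1 _ Hz) (Hg1 _ Hz)), Cnorm_Cdiv_lt_1; auto. }
    assert (R2 : 1 / 2 < fst (Cmul (h2' (to_disc u v)) (to_disc_deriv u v))).
    { apply (dilatation_iff h2 g2 u v _ _ Hs2 Hu (Hh2 _ Hz) (Hg2 _ Hz)), Cnorm_Cdiv_lt_1; auto. }
    replace (fst (Cmul (mix h1' h2' (to_disc u v)) (to_disc_deriv u v))) with
      (t * fst (Cmul (h1' (to_disc u v)) (to_disc_deriv u v)) +
       (1 - t) * fst (Cmul (h2' (to_disc u v)) (to_disc_deriv u v)))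
      by (unfold mix, Cmul, Cadd, Cscale; simpl; ring).
    (* For [t = 0] strictness comes from the second term, otherwise from the first. *)
    destruct (Req_dec t 0) as [-> | Ht0]; [lra | ].
    apply Rminus_lt_0 in R1; apply Rminus_lt_0 in R2.
    assert (K1 := Rmult_lt_0_compat t _ ltac:(lra) R1).
    assert (K2 := Rmult_le_pos (1 - t) _ ltac:(lra) (Rlt_le _ _ R2)).
    lra. }
  (* Since the combination again satisfies [h + g = w], the condition on the real part translates
     back into [|g'| < |h'|], which also forces [h'] to be nonzero. *)
  assert (Hnormsq : forall z, inE z -> normsq (mix g1' g2' z) < normsq (mix h1' h2' z)).
  { intros z Hz; destruct (disc_parametrized z Hz) as [u [v [Hu ->]]].
    apply (dilatation_iff _ _ u v _ _ Hs Hu (Hh _ Hz) (Hg _ Hz)); auto. }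
  assert (Hn : forall z, inE z -> mix h1' h2' z <> Czero).
  { intros z Hz E; specialize (Hnormsq z Hz); rewrite E in Hnormsq.
    pose proof (normsq_ge_0 (mix g1' g2' z)); unfold normsq at 2 in Hnormsq.
    simpl in Hnormsq; lra. }
  destruct (harm_half_plane_convex _ _ _ Hs Hh Hre) as [Hinj [Hconv0 Hconv1]].
  split; [ | split].
  - exists (mix h1 h2), (mix g1 g2); split; [intros z _; apply Hmix | ].
    exists (mix h1' h2'), (mix g1' g2'); repeat (split; [assumption | ]).
    split; [ | split; [exact Hinj | split]].
    + intros z Hz; apply Cnorm_Cdiv_lt_1; auto.
    + rewrite <- Hmix, H01, H02; unfold Cadd, Cscale, Czero; simpl; f_equal; ring.
    + unfold mix; rewrite H11, H12; unfold Cadd, Cscale, Cone; simpl; f_equal; ring.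
  - apply (convex_in_direction_ext (harm (mix h1 h2) (mix g1 g2))); [now intros; rewrite Hmix | trivial].
  - apply (convex_in_direction_ext (harm (mix h1 h2) (mix g1 g2))); [now intros; rewrite Hmix | trivial].
Qed.
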